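(* For every even $r=2t$ with $r\in\{10,18,20\}$ or $r\ge 28$, there exists a binary linear $[n,n-r,3]_2 2$ code with $n=26\cdot2^{r/2-4}-1$; hence $\ell_2(r,2)\le 26\cdot 2^{r/2-4}-1$ for these $r$. Moreover, for even $r\ge42$ the parity-check matrix of this code admits a $2$-partition into at most $2^{\lfloor r/4\rfloor-2}+1$ subsets, and the covering densities $\mu=2^{-r}\big(1+n+\binom n2\big)$ of the codes of this family tend to $26^2/2^9\approx1.3203$ as $r\to\infty$.
   Context: $[n,n-r,d]_2R$: binary linear code of length $n$, codimension $r$, minimum distance $d$, covering radius $R$ (smallest $R$ such that every vector of $\mathbb{F}_2^r$ is a sum of at most $R$ columns of a parity-check matrix). $\ell_2(r,R)$: smallest length of a binary linear code of codimension $r$ and covering radius $R$. A $2$-partition of an $r\times n$ parity-check matrix (covering radius $2$, minimum distance $\ge3$) is a partition of its columns into nonempty subsets such that every vector of $\mathbb{F}_2^r$ is the sum of at most $2$ columns lying in pairwise distinct subsets. *)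

(* Defs.v *)
From mathcomp Require Import all_boot all_order all_algebra.
Set Implicit Arguments. Unset Strict Implicit. Unset Printing Implicit Defensive.
Import Order.TTheory GRing.Theory Num.Theory.
Local Open Scope ring_scope.

(* A binary linear code of length n and codimension r is given by a
   parity-check matrix H : 'M['F_2]_(r, n) of rank r; the code is its kernel
   { x : 'cV_n | H *m x = 0 }.  Columns of H are [col j H]. *)

Definition sum_at_most (r n : nat) (H : 'M['F_2]_(r, n)) (R : nat) (v : 'cV['F_2]_r) :=
  exists S : {set 'I_n}, (#|S| <= R)%N /\ v = \sum_(j in S) col j H.

Definition covering_radius (r n : nat) (H : 'M['F_2]_(r, n)) (R : nat) :=
  (forall v, sum_at_most H R v) /\
  (forall R', (forall v, sum_at_most H R' v) -> (R <= R')%N).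

Definition wt (n : nat) (x : 'cV['F_2]_n) : nat := #|[set j | x j 0 != 0]|.

Definition codeword (r n : nat) (H : 'M['F_2]_(r, n)) (x : 'cV['F_2]_n) := H *m x = 0.

Definition min_distance (r n : nat) (H : 'M['F_2]_(r, n)) (d : nat) :=
  (exists x, x != 0 /\ codeword H x /\ wt x = d) /\
  (forall x, x != 0 -> codeword H x -> (d <= wt x)%N).

Definition is_code (r n : nat) (H : 'M['F_2]_(r, n)) (d R : nat) :=
  \rank H = r /\ min_distance H d /\ covering_radius H R.

Definition is_ell2 (r R l : nat) :=
  (exists H : 'M['F_2]_(r, l), \rank H = r /\ covering_radius H R) /\
  (forall (n : nat) (H : 'M['F_2]_(r, n)), \rank H = r -> covering_radius H R -> (l <= n)%N).

(* 2-partition of the columns of H into k nonempty subsets, given by a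
   surjective labelling c : 'I_n -> 'I_k *)
Definition two_partition (r n : nat) (H : 'M['F_2]_(r, n)) (k : nat) :=
  exists c : 'I_n -> 'I_k,
    (forall i : 'I_k, exists j, c j = i) /\
    (forall v : 'cV['F_2]_r,
        v = 0 \/ (exists j, v = col j H) \/
        (exists i j, c i != c j /\ v = col i H + col j H)).

Definition code_len (r : nat) : nat := (26 * 2 ^ (r./2 - 4) - 1)%N.

Definition density (r : nat) : rat :=
  (1 + code_len r + 'C(code_len r, 2))%N%:R / (2 ^ r)%N%:R.

(* Main.v *)
Require Import Defs.
From mathcomp Require Import all_boot all_order all_algebra all_field.
From mathcomp Require Import zify ring lra.
From Stdlib Require Import Classical.
Set Implicit Arguments. Unset Strict Implicit. Unset Printing Implicit Defensive.
Import Order.TTheory GRing.Theory Num.Theory.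
Local Open Scope ring_scope.

(* The codes come from one [51, 41]_2 2 code and a doubling construction.  A set
   of n nonzero vectors of F_2^r with labels below p is "saturating" when every
   vector is 0, a member, or a sum of two members with distinct labels.  Refine
   the labelling to a surjection b onto the field with q = 2^m elements (possible
   when p <= q <= n) and take in F_2^(r + 2m) the vectors (h_j, x, b_j x), x in
   F_q, together with (0, 0, w), w <> 0.  This is again saturating: for i and j
   with distinct labels the system x + y = u, b_i x + b_j y = v is solvable; a
   target over h_j is corrected by a vector (0, 0, w); and (0, u, b u) is the sum
   of the vectors over any j with b_j = b having x = u and x = 0.  The latter two
   need distinct labels, so each old label is split according to x = 0 or x <> 0,
   and the vectors (0, 0, w) get a label of their own: 2p + 1 labels in all.  The
   length q(n + 1) - 1 preserves the form 26 * 2^(r/2 - 4) - 1.  Since 10 labels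
   suffice for the 51 columns, this reaches r = 18, 20, then all even r from 28
   to 40, and then every even r from about half of it. *)

(** * Vectors over F_2 and field multiplication in coordinates *)

Lemma addmm_F2 m n (A : 'M['F_2]_(m, n)) : A + A = 0.
Proof. by apply/matrixP=> i j; rewrite !mxE; case: (A i j) => [[|[|k]] //= ?]; apply/val_inj. Qed.

Lemma addmK_F2 m n (A B : 'M['F_2]_(m, n)) : A + (A + B) = B.
Proof. by rewrite addrA addmm_F2 add0r. Qed.

Lemma addm_eq0_F2 m n (A B : 'M['F_2]_(m, n)) : A + B = 0 -> A = B.
Proof. by move=> AB0; rewrite -[B](addmK_F2 A) AB0 addr0. Qed.

(** Field multiplication by [b], reduced to what the construction uses: additive maps, any two
    distinct ones agreeing at 0 only. *)
Definition spread_set m (M : 'I_(2 ^ m) -> 'cV['F_2]_m -> 'cV['F_2]_m) :=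
  (forall b, {morph M b : x y / x + y}) /\
  (forall b b' x, x != 0 -> M b x = M b' x -> b = b').

Lemma spread_set_exists m : (0 < m)%N -> exists M, @spread_set m M.
Proof.
move=> m_gt0; have [F F2 cardF] := pPrimePowerField (isT : prime 2) m_gt0.
have [f f_lin [g fK gK]] := pprimeChar_vectAxiom F2.
(* The coordinate space has dimension [logn 2] of the field order; generalizing it lets the equation
   with [m] be substituted in the types. *)
have En : logn 2 #|pPrimeCharType F2| = m by rewrite [#|_|]cardF pfactorK.
move: (logn _ _) En f f_lin g fK gK => n -> {n} f f_lin g fK gK.
have fD : {morph f : x y / x + y} by move=> x y; have := f_lin 1 x y; rewrite !scale1r.
have f0 : f 0 = 0 by apply: (addrI (f 0)); rewrite -fD !addr0.
have gD : {morph g : x y / x + y} by move=> x y; apply: (can_inj fK); rewrite fD !gK.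
pose e (b : 'I_(2 ^ m)) : F := enum_val (cast_ord (esym cardF) b).
exists (fun b x => (f (e b * g x^T : F))^T); split=> [b x y|b b' x x0].
  by rewrite linearD gD mulrDr fD linearD.
move/trmx_inj/(can_inj fK)/mulIf => eq_e.
suff /eq_e/enum_val_inj/cast_ord_inj : (g x^T : F) != 0 by [].
apply: contra x0 => /eqP gx0; rewrite -[x]trmxK -[x^T]gK [g _]gx0.
by rewrite f0 trmx0.
Qed.

Section SpreadSet.

Variables (m : nat) (M : 'I_(2 ^ m) -> 'cV['F_2]_m -> 'cV['F_2]_m).
Hypothesis spreadM : spread_set M.

Lemma spread_set0 b : M b 0 = 0.
Proof. by apply: (addrI (M b 0)); rewrite -(spreadM.1 b) !addr0. Qed.

(** For fixed nonzero [x], the map sending [b] to [M b x] is injective between sets of size 2^m,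
    hence onto. *)
Lemma spread_set_line x y : x != 0 -> exists b, M b x = y.
Proof.
move=> x0; have inj : injective (M^~ x) by move=> b b'; apply: spreadM.2.
have [] := inj_card_bij inj; first by rewrite card_mx card_Fp // card_ord muln1.
by move=> k _ kK; exists (k y); rewrite kK.
Qed.

(** Once [M b y] is moved to the right, the unknown enters through [M b + M b'], which is injective
    as the two maps agree only at 0. *)
Lemma spread_set_solve b b' y z :
  b != b' -> exists x, M b (y + x) + M b' x = z.
Proof.
move=> bb'; have [MD Minj] := spreadM.
have inj : injective (fun x => M b x + M b' x).
  move=> x x' /= Exx'; apply: addm_eq0_F2; apply/eqP; apply: contraNT bb' => xx'0.
  apply/eqP/(Minj _ _ _ xx'0)/addm_eq0_F2.
  by rewrite !MD addrACA Exx' addmm_F2.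
have [k _ kK] := injF_bij inj.
by exists (k (z + M b y)); rewrite MD -addrA kK addrCA addmm_F2 addr0.
Qed.

End SpreadSet.

(** * Labellings and saturating sets *)

Lemma label_image (T : finType) (c : T -> nat) p : (forall j, c j < p)%N ->
  exists k (d : T -> 'I_k), [/\ (k <= p)%N, forall i, exists j, d j = i &
    forall i j, (d i == d j) = (c i == c j)].
Proof.
move=> cp; pose s := undup (codom c).
have c_s j : c j \in s by rewrite mem_undup codom_f.
have ltc j : (index (c j) s < size s)%N by rewrite index_mem.
exists (size s), (fun j => Ordinal (ltc j)); split=> [|i|i j].
- rewrite -(size_iota 0 p); apply: uniq_leq_size; rewrite ?undup_uniq // => x.
  by rewrite mem_undup mem_iota => /codomP[j ->]; apply: cp.
- have : nth 0%N s i \in s by rewrite mem_nth.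
  rewrite mem_undup => /codomP[j Ej]; exists j; apply: val_inj => /=.
  by rewrite -Ej index_uniq ?undup_uniq.
rewrite -val_eqE /=; apply/eqP/eqP=> [/(congr1 (nth 0%N s))|-> //].
by rewrite !nth_index.
Qed.

(** By pigeonhole two elements share a label; one of them can take the new label without emptying
    the old class. *)
Lemma label_split (T : finType) q (b : T -> 'I_q) :
    (forall i, exists j, b j = i) -> (q < #|T|)%N ->
  exists b' : T -> 'I_q.+1, (forall i, exists j, b' j = i) /\
    (forall i j, b' i = b' j -> b i = b j).
Proof.
move=> b_surj qT; have /injectivePn[i [j ij Eb]] : ~~ injectiveb b.
  by apply/injectiveP => /leq_card; rewrite card_ord leqNgt qT.
exists (fun x => if x == i then ord_max else widen_ord (leqnSn q) (b x)).
split=> [y|x y].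
  have [/eqP yq|yq] := boolP (y == ord_max).
    by exists i; rewrite eqxx yq.
  have ltyq : (y < q)%N by move: yq; rewrite -val_eqE /=; have := ltn_ord y; lia.
  have [x bx] := b_surj (Ordinal ltyq).
  (* If the preimage found is the relabelled [i], its twin [j] still carries the old label. *)
  have [Exi|nxi] := eqVneq x i; last first.
    by exists x; rewrite (negPf nxi); apply: val_inj; rewrite /= bx.
  exists j; rewrite eq_sym (negPf ij); apply: val_inj; rewrite /= -Eb -Exi.
  by rewrite bx.
have [-> | _] := eqVneq x i; have [-> | _] := eqVneq y i => //.
- by move/(congr1 val) => /= E; have := ltn_ord (b y); lia.
- by move/(congr1 val) => /= E; have := ltn_ord (b x); lia.
by move/(congr1 val) => /= E; apply: val_inj.
Qed.

Lemma label_refine (T : finType) (c : T -> nat) p q :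
    (forall j, c j < p)%N -> (p <= q <= #|T|)%N ->
  exists b : T -> 'I_q, (forall i, exists j, b j = i) /\
    (forall i j, b i = b j -> c i = c j).
Proof.
move=> /label_image[k [d [kp d_surj d_c]]] /andP[/(leq_trans kp) kq].
rewrite -(subnKC kq); elim: (q - k)%N => [|e IHe] leT.
  rewrite addn0; exists d; split=> // i j /eqP.
  by rewrite d_c => /eqP.
have lt_e : (k + e < #|T|)%N by rewrite -addnS.
have [b [b_surj b_c]] := IHe (ltnW lt_e).
have [b' [b'_surj b'_b]] := label_split b_surj lt_e.
by rewrite addnS; exists b'; split=> // i j /b'_b/b_c.
Qed.

(** The dependent triple will give a codeword of weight 3. Labels are only bounded by [p]; empty
    classes are removed when the code is formed. *)
Definition saturating r n p := exists (T : finType) (h : T -> 'cV['F_2]_r) (c : T -> nat),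
  [/\ #|T| = n, injective h /\ (forall j, h j != 0), forall j, (c j < p)%N,
      exists i j k, h i + h j = h k &
      forall v, [\/ v = 0, exists j, v = h j |
                 exists i j, c i != c j /\ v = h i + h j]].

(** * Extension by the field with 2^m elements *)

Lemma saturating_extend r n p m :
    (0 < m)%N -> (p <= 2 ^ m <= n)%N -> saturating r n p ->
  saturating (r + (m + m)) (2 ^ m * n.+1 - 1) (p.*2.+1).
Proof.
move=> m_gt0 pmn [T [h [c [cardT [h_inj h0] c_lt [i1 [i2 [i3 h123]]] h_sat]]]].
have [M spreadM] := spread_set_exists m_gt0; have [MD _] := spreadM.
rewrite -cardT in pmn *.
have [b [b_surj b_c]] := label_refine c_lt pmn.
pose W := {w : 'cV['F_2]_m | w != 0}.
pose T' := (T * 'cV['F_2]_m + W)%type.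
pose h' (j : T') := match j with
  | inl (j, x) => col_mx (h j) (col_mx x (M (b j) x))
  | inr w => col_mx 0 (col_mx 0 (val w)) end.
(* The low bit tells whether [x] vanishes, the rest is the old label; [p.*2] lies above all of
   these. *)
pose c' (j : T') := match j with
  | inl (j, x) => ((x != 0)%R + (c j).*2)%N
  | inr w => p.*2 end.
exists T', h', c'; split.
- have cV : #|{: 'cV['F_2]_m}| = (2 ^ m)%N by rewrite card_mx card_Fp // muln1.
  rewrite card_sum card_prod cV card_sig.
  have -> : #|[pred w : 'cV['F_2]_m | w != 0]| = (2 ^ m - 1)%N.
    have := cardC1 (0 : 'cV['F_2]_m); rewrite cV subn1 => <-.
    by apply: eq_card => w; rewrite !inE.
  have := expn_gt0 2 m; lia.
- split=> [[[i x]|w] [[j y]|w']|[[i x]|w]] /=.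
  + by move/eq_col_mx => [/h_inj-> /eq_col_mx[-> _]].
  + by move/eq_col_mx => [hi0]; have := h0 i; rewrite hi0 eqxx.
  + by move/eq_col_mx => [hi0]; have := h0 j; rewrite -hi0 eqxx.
  + by move/eq_col_mx => [_ /eq_col_mx[_ /val_inj->]].
  + by rewrite col_mx_eq0 negb_and h0.
  + by rewrite !col_mx_eq0 !eqxx /= (valP w).
- by move=> [[i x]|w] /=; [have := c_lt i|]; lia.
- exists (inl (i1, 0)), (inl (i2, 0)), (inl (i3, 0)) => /=.
  by rewrite !(spread_set0 spreadM) !add_col_mx !addr0 h123.
move=> v; rewrite -[v]vsubmxK -[dsubmx v]vsubmxK.
move: (usubmx v) (usubmx (dsubmx v)) (dsubmx (dsubmx v)) => a y z {v}.
have [-> | [i ->] | [i [j [cij ->]]]] := h_sat a.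
- have [-> | y0] := eqVneq y 0.
    have [-> | z0] := eqVneq z 0; first by constructor 1; rewrite !col_mx0.
    by constructor 2; exists (inr (Sub z z0)).
  have [k <-] := spread_set_line spreadM z y0.
  have [j <-] := b_surj k.
  constructor 3; exists (inl (j, y)), (inl (j, 0)) => /=.
  rewrite !add_col_mx (spread_set0 spreadM) addmm_F2 !addr0 y0 eqxx.
  by split=> //; lia.
- have [-> | z0] := eqVneq z (M (b i) y).
    by constructor 2; exists (inl (i, y)).
  have w0 : M (b i) y + z != 0.
    by apply: contra z0 => /eqP/addm_eq0_F2->.
  constructor 3; exists (inl (i, y)), (inr (Sub (M (b i) y + z) w0)) => /=.
  rewrite !add_col_mx !addr0 addmK_F2; split=> //.
  by have := c_lt i; case: (y != 0); lia.
have bij : b i != b j by apply: contra cij => /eqP/b_c->.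
have [x Ex] := spread_set_solve spreadM y z bij.
constructor 3; exists (inl (i, y + x)), (inl (j, x)) => /=.
rewrite !add_col_mx Ex -addrA addmm_F2 addr0; split=> //.
by case: (y + x != 0); case: (x != 0); lia.
Qed.

(** * The computed check of the 51 columns *)

Fixpoint bits k x : seq bool :=
  if k is k'.+1 then odd x :: bits k' x./2 else [::].

Lemma size_bits k x : size (bits k x) = k.
Proof. by elim: k x => //= k IHk x; rewrite IHk. Qed.

Definition xorw s t := [seq u.1 (+) u.2 | u <- zip s t].

(** The finite check runs on boolean lists, which [vm_compute] handles well; this map carries its
    outcome to vectors. *)
Definition vec_of_word k (s : seq bool) : 'cV['F_2]_k := \col_i (nth false s i)%:R.

Lemma vec_of_xorw k s t : size s = k -> size t = k ->
  vec_of_word k (xorw s t) = vec_of_word k s + vec_of_word k t.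
Proof.
move=> ss st; apply/colP=> i; rewrite !mxE.
rewrite (nth_map (false, false)) ?size_zip ?ss ?st ?minnn // nth_zip ?ss ?st //=.
by case: (nth _ s i); case: (nth _ t i); apply: val_inj.
Qed.

Lemma vec_of_word_inj k s t : size s = k -> size t = k ->
  vec_of_word k s = vec_of_word k t -> s = t.
Proof.
move=> ss st Est; apply: (@eq_from_nth _ false); rewrite ss ?st // => i ik.
have /colP/(_ (Ordinal ik)) := Est; rewrite !mxE /=.
by case: (nth _ s i); case: (nth _ t i).
Qed.

Lemma vec_of_word_surj k (v : 'cV['F_2]_k) :
  exists2 s, size s = k & v = vec_of_word k s.
Proof.
exists [seq v i 0 == 1 | i <- enum 'I_k]; first by rewrite size_map size_enum_ord.
apply/colP=> i; rewrite !mxE (nth_map i) ?size_enum_ord // nth_ord_enum.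
by case: (v i 0) => [[|[|]] //= ?]; apply: val_inj.
Qed.

(* A trie descent: checking all [2 ^ k] words costs one pass over [L] per
   level instead of one search per word. *)
Fixpoint covers k (L : seq (seq bool)) : bool :=
  if k is k'.+1 then covers k' [seq behead s | s <- L & head false s]
                  && covers k' [seq behead s | s <- L & ~~ head false s]
  else ~~ nilp L.

(** The size hypothesis excludes empty words at positive depth, where [head false] and [behead]
    would return defaults. *)
Lemma coversP k L : {in L, forall s, size s = k} -> covers k L ->
  forall s, size s = k -> s \in L.
Proof.
elim: k L => [|k IHk] L sizeL /=.
  by case: L sizeL => // t L sizeL _ s /size0nil->; rewrite -(size0nil (sizeL t _)) mem_head.
have size_behead (P : pred (seq bool)) :
    {in [seq behead s | s <- L & P s], forall s, size s = k}.
  by move=> _ /mapP[s + ->]; rewrite mem_filter size_behead => /andP[_ /sizeL->].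
case/andP=> covT covF [|x s] //= [ss].
have [t] : exists2 t, t \in [seq t <- L | head false t == x] & s = behead t.
  apply/mapP; case: x.
    rewrite (eq_filter (a2 := head false)); first exact: IHk covT _ ss.
    by move=> t /=; rewrite eqb_id.
  rewrite (eq_filter (a2 := fun t => ~~ head false t)); first exact: IHk covF _ ss.
  by move=> t /=; rewrite eqbF_neg.
by rewrite mem_filter => /andP[/eqP <- tL] ->; case: t tL (sizeL t tL).
Qed.

(* Pairs (column, label), a column being the binary expansion of a number below
   [2 ^ 10].  Found by simulated annealing among the sets invariant under a
   linear map of order 3 that fixes a 4-dimensional subspace pointwise. *)
Definition columns51 : seq (nat * nat) :=
  [:: (11, 6); (15, 8); (1006, 0); (670, 7); (382, 3); (891, 2); (747, 4);
    (411, 4); (929, 5); (593, 7); (497, 3); (1010, 6); (674, 6); (338, 6);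
    (805, 0); (533, 7); (309, 3); (874, 0); (730, 7); (442, 9); (2, 4);
    (986, 3); (698, 5); (362, 2); (823, 1); (551, 1); (279, 1); (948, 3);
    (612, 7); (468, 3); (3, 8); (913, 9); (625, 5); (481, 7); (853, 9);
    (757, 5); (421, 7); (819, 8); (547, 8); (275, 8); (798, 9); (574, 0);
    (302, 7); (7, 1); (1017, 4); (681, 6); (345, 6); (9, 4); (955, 0); (619,
    1); (475, 8)].

Lemma saturating51 : saturating 10 51 10.
Proof.
pose word (a : nat * nat) := bits 10 a.1.
pose pairs := [seq (a, b) | a <- columns51, b <- columns51].
pose L := nseq 10 false :: [seq word a | a <- columns51] ++
  [seq xorw (word u.1) (word u.2) | u <- pairs & u.1.2 != u.2.2].
have covL : covers 10 L by vm_compute.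
have sizeL : {in L, forall s, size s = 10%N}.
  move=> s; rewrite inE mem_cat => /or3P[/eqP->|/mapP[a _ ->]|/mapP[u _ ->]] //.
have word_uniq : uniq [seq word a | a <- columns51] by vm_compute.
have word_n0 : nseq 10 false \notin [seq word a | a <- columns51] by vm_compute.
have labels : all (fun a => a.2 < 10)%N columns51 by vm_compute.
have size51 : size columns51 = 51%N by [].
(* The dependent triple is 1010 xor 11 = 1017. *)
have triple : xorw (word (nth (0, 0)%N columns51 11)) (word (nth (0, 0)%N columns51 0))
              = word (nth (0, 0)%N columns51 44) by vm_compute.
(* The computed facts suffice from here on; abstracting the list keeps conversion from evaluating
   it. *)
move: columns51 @pairs @L covL sizeL word_uniq word_n0 labels size51 triple.
move=> cols pairs L covL sizeL word_uniq word_n0 labels size51 triple.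
pose col (i : 'I_51) := nth (0, 0)%N cols i.
have lt51 (i : 'I_51) : (i < size cols)%N by rewrite size51.
have size_word a : size (word a) = 10%N by apply: size_bits.
have col_index a : a \in cols -> exists i, a = col i.
  move=> a_cols; have lt_i : (index a cols < 51)%N by rewrite -size51 index_mem.
  by exists (Ordinal lt_i); rewrite /col nth_index.
have col_in i : word (col i) \in [seq word a | a <- cols] by rewrite map_f ?mem_nth.
exists 'I_51, (fun i => vec_of_word 10 (word (col i))), (fun i => (col i).2); split.
- exact: card_ord.
- split=> [i j /vec_of_word_inj|i].
    rewrite !size_word => /(_ erefl erefl) Eij; apply/val_inj/eqP.
    rewrite -(nth_uniq [::] _ _ word_uniq) ?size_map ?lt51 //.
    by rewrite !(nth_map (0, 0)%N) ?lt51 // Eij.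
  apply: contraNneq word_n0 => h0; suff <- : word (col i) = nseq 10 false by [].
  apply: (@vec_of_word_inj 10); rewrite ?size_word // h0.
  by apply/colP=> j; rewrite !mxE nth_nseq if_same.
- by move=> i; apply: (allP labels); rewrite mem_nth.
- exists (inord 11), (inord 0), (inord 44).
  by rewrite -vec_of_xorw ?size_word // /col !inordK ?triple.
move=> v; have [s /(coversP sizeL covL) + ->] := vec_of_word_surj v.
rewrite inE mem_cat => /or3P[/eqP->|/mapP[a /col_index[i ->] ->]|/mapP[u + ->]].
- by constructor 1; apply/colP=> j; rewrite !mxE nth_nseq if_same.
- by constructor 2; exists i.
rewrite mem_filter => /andP[+ /allpairsP[[a b] /= [/col_index[i ->] /col_index[j ->] Eu]]].
rewrite {}Eu => /= cij; constructor 3; exists i, j.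
by rewrite vec_of_xorw ?size_word.
Qed.

(** * From saturating sets to codes *)

Section CodeOfColumns.

Variables (r : nat) (T : finType) (h : T -> 'cV['F_2]_r).

Definition matrix_of_columns : 'M['F_2]_(r, #|T|) :=
  \matrix_(i, j) h (enum_val j) i 0.

Lemma col_matrix_of_columns j : col j matrix_of_columns = h (enum_val j).
Proof. by apply/colP=> i; rewrite !mxE. Qed.

End CodeOfColumns.

Lemma mulmx_F2_sum_col r n (H : 'M['F_2]_(r, n)) (x : 'cV['F_2]_n) :
  H *m x = \sum_(j in [set j | x j 0 != 0]) col j H.
Proof.
apply/colP=> i; rewrite !mxE summxE [RHS]big_mkcond /=; apply: eq_bigr => j _.
rewrite inE !mxE; case: eqP => [->|]; rewrite ?mulr0 //=.
case: (x j 0) => [[|[|]] //= ?]; first by case; apply: val_inj.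
by move=> _; rewrite -[RHS]mulr1; congr (_ * _); apply: val_inj.
Qed.

(** The columns span the space, so a row vector that kills all of them kills every unit vector. *)
Lemma rank_of_covering r n (H : 'M['F_2]_(r, n)) R :
  (forall v, sum_at_most H R v) -> \rank H = r.
Proof.
move=> covH; apply/eqP/inj_row_free => u uH0; apply/rowP=> i; rewrite mxE.
have [S [_ Ei]] := covH (delta_mx i 0).
have : u *m delta_mx i (0 : 'I_1) = 0.
  rewrite Ei mulmx_sumr big1 // => j _.
  by rewrite colE mulmxA uH0 mul0mx.
by move/matrixP/(_ 0 0); rewrite -colE !mxE.
Qed.

(** Radius 1 fails by counting: sums of at most one column give at most n + 1 vectors. Distinct
    nonzero columns exclude weights 1 and 2. *)
Lemma saturating_code r n p : saturating r n p -> (n.+1 < 2 ^ r)%N ->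
  exists H : 'M['F_2]_(r, n), is_code H 3 2 /\
    exists k, (k <= p)%N /\ two_partition H k.
Proof.
move=> [T [h [c [<- [h_inj h0] c_lt [i1 [i2 [i3 h123]]] h_sat]]]] ltTr.
set H := matrix_of_columns h; exists H.
have colH i : col i H = h (enum_val i) := col_matrix_of_columns h i.
have colHr j : col (enum_rank j) H = h j by rewrite colH enum_rankK.
have covH v : sum_at_most H 2 v.
  have [-> | [j ->] | [i [j [cij ->]]]] := h_sat v.
  - by exists set0; rewrite cards0 big_set0.
  - by exists [set enum_rank j]; rewrite cards1 big_set1 colHr.
  exists [set enum_rank i; enum_rank j]; rewrite cards2; split; first by case: eqP.
  have ij : enum_rank i \notin [set enum_rank j].
    by rewrite inE; apply: contra cij => /eqP/enum_rank_inj->.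
  by rewrite big_setU1 // big_set1 !colHr.
split; last first.
  have [k [d [kp d_surj d_c]]] := label_image c_lt.
  exists k; split=> //; exists (fun i => d (enum_val i)); split=> [i|v].
    by have [j <-] := d_surj i; exists (enum_rank j); rewrite enum_rankK.
  have [-> | [j ->] | [i [j [cij ->]]]] := h_sat v; [by left|right..].
    by left; exists (enum_rank j); rewrite colHr.
  right; exists (enum_rank i), (enum_rank j).
  by rewrite !colHr !enum_rankK d_c.
split; first exact: rank_of_covering covH.
split; last first.
  split=> // R' covR'; rewrite leqNgt; apply/negP => ltR'.
  (* [None] stands for the empty sum. *)
  pose f (o : option T) := if o is Some j then h j else 0.
  have f_surj v : v \in codom f.
    have [S [cardS ->]] := covR' v.
    have : (#|S| <= 1)%N by apply: leq_trans cardS _.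
    rewrite leq_eqVlt ltnS leqn0 => /orP[/cards1P[j ->]|]; last first.
      by rewrite cards_eq0 => /eqP->; rewrite big_set0; apply: (codom_f f None).
    by rewrite big_set1 colH; apply: (codom_f f (Some _)).
  have : (#|{: 'cV['F_2]_r}| <= #|codom f|)%N by apply/subset_leq_card/subsetP.
  rewrite card_mx card_Fp // muln1 leqNgt => /negP; apply.
  by apply: leq_ltn_trans (leq_image_card _ _) _; rewrite card_option.
split.
  exists (\col_j ((enum_val j \in [set i1; i2; i3])%:R)).
  (* If two indices of the triple coincided, the remaining column would be zero. *)
  have ne12 : i1 != i2.
    by apply: contra (h0 i3) => /eqP E; rewrite -h123 E addmm_F2.
  have ne13 : i1 != i3.
    apply: contra (h0 i2) => /eqP E.
    by rewrite -(addmK_F2 (h i1) (h i2)) h123 E addmm_F2.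
  have ne23 : i2 != i3.
    apply: contra (h0 i1) => /eqP E.
    by rewrite -(addmK_F2 (h i2) (h i1)) [h i2 + h i1]addrC h123 E addmm_F2.
  set x := \col_j _.
  have suppx : [set j | x j 0 != 0] = enum_rank @: [set i1; i2; i3].
    apply/setP=> j; rewrite inE mxE -[j in RHS]enum_valK (mem_imset _ _ enum_rank_inj).
    by case: (_ \in _).
  have wx : wt x = 3.
    rewrite /wt suppx (card_imset _ enum_rank_inj) setUC cardsU1 cards2 ne12 !inE negb_or.
    by rewrite ![i3 == _]eq_sym ne13 ne23.
  split; last split=> //.
    apply/eqP => x0; move: wx; rewrite /wt x0.
    by rewrite eq_card0 // => j; rewrite !inE mxE eqxx.
  rewrite /codeword mulmx_F2_sum_col suppx big_imset /=; last by move=> ? ? _ _ /enum_rank_inj.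
  rewrite setUC big_setU1 ?inE ?negb_or ?[i3 == _]eq_sym ?ne13 ?ne23 //=.
  by rewrite big_setU1 ?inE // big_set1 !colHr /= h123 addmm_F2.
move=> x x0; rewrite /codeword mulmx_F2_sum_col /wt; set S := [set j | _] => sumS.
have {x0} S0 : S != set0.
  apply: contraNneq x0 => S0; apply/eqP/colP=> j; rewrite mxE.
  by have /setP/(_ j) := S0; rewrite !inE => /negbFE/eqP.
rewrite -cards_eq0 in S0.
rewrite ltn_neqAle eq_sym; apply/andP; split.
  apply/negP => /cards2P[i [j [ij ES]]].
  move: sumS; rewrite ES big_setU1 ?inE // big_set1 !colH.
  by move/addm_eq0_F2/h_inj/enum_val_inj/eqP; rewrite (negPf ij).
rewrite ltn_neqAle lt0n S0 andbT eq_sym; apply/negP => /cards1P[i ES].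
by have := h0 (enum_val i); rewrite -colH -sumS ES big_set1 eqxx.
Qed.

(** Descent to the least length, excluded middle deciding whether a shorter one occurs. *)
Lemma ell2_exists r R n : (exists H : 'M['F_2]_(r, n), \rank H = r /\ covering_radius H R) ->
  exists l, is_ell2 r R l /\ (l <= n)%N.
Proof.
elim/ltn_ind: n => n IHn Hn.
have [[m [lt_mn Hm]]|no_less] := classic (exists m, (m < n)%N /\
    exists H : 'M['F_2]_(r, m), \rank H = r /\ covering_radius H R).
  by have [l [l_min /leq_trans/(_ (ltnW lt_mn))]] := IHn m lt_mn Hm; exists l.
exists n; split=> //; split=> // m H rkH covH; rewrite leqNgt; apply/negP => lt_mn.
by apply: no_less; exists m; split=> //; exists H.
Qed.

(** * Iterating the extension from codimension 10 *)

Lemma code_len_double t : code_len t.*2 = (26 * 2 ^ (t - 4) - 1)%N.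
Proof. by rewrite /code_len doubleK. Qed.

Lemma saturating_le r n p q : (p <= q)%N -> saturating r n p -> saturating r n q.
Proof.
move=> pq [T [h [c [cardT hT c_lt triple h_sat]]]]; exists T, h, c; split=> // j.
exact: leq_trans (c_lt j) pq.
Qed.

(** The bound [m <= t] gives enough columns for the refinement: 2^m <= 2^t = 16 * 2^(t-4), which is
    at most the length 26 * 2^(t-4) - 1. *)
Lemma saturating_code_len_extend t m p q : (4 < t)%N -> (0 < m <= t)%N -> (p <= 2 ^ m)%N ->
    (p.*2 < q)%N ->
  saturating t.*2 (code_len t.*2) p -> saturating (t + m).*2 (code_len (t + m).*2) q.
Proof.
move=> t_gt4 /andP[m_gt0 le_mt] pm pq sat_t; apply: saturating_le pq _.
have A_gt0 : (0 < 2 ^ (t - 4))%N by rewrite expn_gt0.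
have le_2 : (2 ^ m <= 2 ^ t)%N by rewrite leq_exp2l.
have E2t : (2 ^ t = 16 * 2 ^ (t - 4))%N by rewrite -(expnD 2 4) subnKC // ltnW.
have pmn : (p <= 2 ^ m <= code_len t.*2)%N.
  by rewrite pm code_len_double /=; lia.
have := saturating_extend m_gt0 pmn sat_t.
rewrite addnn -doubleD code_len_double.
rewrite [code_len (t + m).*2]code_len_double addnC -addnBA ?(ltnW t_gt4) // expnD.
by rewrite -subSn ?muln_gt0 ?A_gt0 // subSS subn0 mulnC -mulnA (mulnC (2 ^ m)%N).
Qed.

(** Here [t] is r/2. The 10 initial labels become 21 and then 43 after two extensions; the other
    value is the bound of the theorem. *)
Definition label_bound t := if (t <= 20)%N then 43%N else (2 ^ (t./2 - 2) + 1)%N.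

Lemma saturating_small :
  [/\ saturating 10 (code_len 10) 10, saturating 18 (code_len 18) 21
    & saturating 20 (code_len 20) 21].
Proof.
have sat5 : saturating 5.*2 (code_len 5.*2) 10 := saturating51.
split; first exact: sat5.
  (* With 10 labels and t = 5, only m = 4 and m = 5 satisfy 10 <= 2^m and m <= t. *)
  exact: (@saturating_code_len_extend 5 4 10 21).
exact: (@saturating_code_len_extend 5 5 10 21).
Qed.

Lemma saturating_large t : (14 <= t)%N ->
  saturating t.*2 (code_len t.*2) (label_bound t).
Proof.
have [_ sat9 sat10] := saturating_small.
elim/ltn_ind: t => t IHt t_ge14; have [t_le20|t_gt20] := leqP t 20.
  rewrite /label_bound t_le20; have [t_le18|t_gt18] := leqP t 18.
    (* With 21 labels m >= 5 is required, and m <= 9: this yields 14 to 18. The values 19 and 20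
       come from 10. *)
    have -> : t = (9 + (t - 9))%N by lia.
    apply: (@saturating_code_len_extend 9 _ 21) => //; first by lia.
    by apply: (@leq_trans (2 ^ 5)); rewrite // leq_exp2l //; lia.
  have -> : t = (10 + (t - 10))%N by lia.
  apply: (@saturating_code_len_extend 10 _ 21) => //; first by lia.
  by apply: (@leq_trans (2 ^ 9)); rewrite // leq_exp2l //; lia.
have -> : label_bound t = (2 ^ (t./2 - 2)).+1.
  by rewrite /label_bound leqNgt t_gt20 addn1.
(* For 21 <= t < 28 one extension of the case 14 suffices, since 43 <= 2^7 and 2 * 43 <= 2^8. *)
have [t_lt28|t_ge28] := ltnP t 28.
  have sat14 : saturating 14.*2 (code_len 14.*2) 43 by apply: IHt => //; lia.
  have {1 2}-> : (t = 14 + (t - 14))%N by lia.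
  apply: saturating_code_len_extend sat14 => //; first by lia.
    by apply: (@leq_trans (2 ^ 7)); rewrite // leq_exp2l //; lia.
  by rewrite ltnS; apply: (@leq_trans (2 ^ 8)); rewrite // leq_exp2l //; lia.
(* From 28 on, the upper half of [t] is at least 14 and is extended by the lower half. *)
have sat_half : saturating (uphalf t).*2 (code_len (uphalf t).*2) (label_bound (uphalf t)).
  by apply: IHt; lia.
have bound : ((label_bound (uphalf t)).*2 <= 2 ^ (t./2 - 2))%N.
  have -> : (t./2 - 2 = (t./2 - 3).+1)%N by lia.
  rewrite expnS mul2n leq_double /label_bound.
  have [_|half_gt20] := leqP (uphalf t) 20.
    by apply: (@leq_trans (2 ^ 6)); rewrite // leq_exp2l //; lia.
  have -> : (t./2 - 3 = (t./2 - 4).+1)%N by lia.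
  rewrite expnS mul2n -addnn leq_add ?expn_gt0 // leq_exp2l //; lia.
have le_half : (label_bound (uphalf t) <= 2 ^ t./2)%N.
  rewrite (leq_trans (leq_trans _ bound)) ?leq_exp2l //; lia.
have {1 2}-> : (t = uphalf t + t./2)%N by lia.
by apply: saturating_code_len_extend sat_half => //; lia.
Qed.

Lemma code_len_lt t : (4 < t)%N -> ((code_len t.*2).+1 < 2 ^ t.*2)%N.
Proof.
move=> t_gt4; rewrite code_len_double.
have A_gt0 : (1 < 2 ^ (t - 4))%N by rewrite -{1}(expn0 2) ltn_exp2l //; lia.
have -> : (t.*2 = 8 + (t - 4) + (t - 4))%N by lia.
by rewrite !expnD; nia.
Qed.

(** * Limit of the covering density *)

Lemma density_close t : (4 <= t)%N ->
  `|density t.*2 - (26 ^ 2)%N%:R / (2 ^ 9)%N%:R| <= (2 ^ (t - 4))%N%:R^-1.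
Proof.
move=> t_ge4; rewrite /density code_len_double.
have -> : (2 ^ t.*2 = 256 * (2 ^ (t - 4)) ^ 2)%N.
  by rewrite -expnM -[256%N]/(2 ^ 8)%N -expnD; congr (_ ^ _)%N; lia.
have A_gt0 : (0 < 2 ^ (t - 4))%N by rewrite expn_gt0.
move: (2 ^ (t - 4))%N A_gt0 => A A_gt0; set n := (26 * A - 1)%N.
have a_ge1 : (1 : rat) <= A%:R by rewrite ler1n.
(* With n + 1 = 26A this is 2(1 + n + C(n,2)) = (n+1)^2 - (n+1) + 2, written without natural
   subtraction. *)
have En : ((1 + n + 'C(n, 2)) * 2 + 26 * A = 676 * A ^ 2 + 2)%N.
  have := mul_bin_diag n 1; rewrite bin1.
  have EA : (26 * A = n.+1)%N by rewrite /n; lia.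
  have -> : (676 * A ^ 2 = (26 * A) ^ 2)%N by rewrite expnMn.
  by rewrite EA; case: n EA => [|k] /=; [lia | nia].
move: (1 + n + _)%N En => x En {n}.
have E : x%:R * 2 + 26 * A%:R = 676 * A%:R ^+ 2 + 2 :> rat.
  by rewrite -natrX -!natrM -!natrD En.
have -> : x%:R = (676 * A%:R ^+ 2 + 2 - 26 * A%:R) / 2 :> rat by lra.
rewrite (natrM _ 256) (natrX _ A).
move: (A%:R : rat) a_ge1 => a a_ge1 {E}.
have a_n0 : a != 0 by rewrite gt_eqF // (lt_le_trans ltr01).
have -> : (676 * a ^+ 2 + 2 - 26 * a) / 2 / (256 * a ^+ 2) - (26 ^ 2)%N%:R / (2 ^ 9)%N%:R
   = a^-1 * (a^-1 / 256 - 13 / 256).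
  by rewrite (natrX _ 26) (natrX _ 2); field.
have a_V : 0 <= a^-1 <= 1.
  by rewrite invr_ge0 invf_le1 ?a_ge1 ?(le_trans ler01) // (lt_le_trans ltr01).
rewrite ler_norml; nra.
Qed.

Theorem theorem5p7 :
  (forall r : nat, ~~ odd r -> (r \in [:: 10; 18; 20]%N) || (28 <= r)%N ->
     (exists H : 'M['F_2]_(r, code_len r),
        is_code H 3 2 /\
        ((42 <= r)%N -> exists k, (k <= 2 ^ (r %/ 4 - 2) + 1)%N /\ two_partition H k)) /\
     (exists l, is_ell2 r 2 l /\ (l <= code_len r)%N)) /\
  (forall eps : rat, 0 < eps -> exists N : nat, forall r : nat,
     (N <= r)%N -> ~~ odd r ->
     `|density r - (26 ^ 2)%N%:R / (2 ^ 9)%N%:R| < eps).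
Proof.
split=> [r r_even r_ok|eps eps_gt0].
  have [p [sat_r p_le]] : exists p, saturating r (code_len r) p /\
      ((42 <= r)%N -> (p <= 2 ^ (r %/ 4 - 2) + 1)%N).
    have [sat10 sat18 sat20] := saturating_small.
    case/orP: r_ok => [|r_ge28].
      rewrite !inE => /or3P[] /eqP->.
      - by exists 10%N.
      - by exists 21%N.
      - by exists 21%N.
    have Er : r = r./2.*2 by rewrite even_halfK.
    exists (label_bound r./2); split.
      by rewrite {1 2}Er; apply: saturating_large; lia.
    move=> r_ge42; have -> : (r %/ 4 = r./2./2)%N by lia.
    by rewrite /label_bound ifF //; lia.
  have [|H [codeH [k [kp partH]]]] := saturating_code sat_r.
    rewrite -(even_halfK r_even); apply: code_len_lt.
    by case/orP: r_ok => [|]; [rewrite !inE => /or3P[] /eqP-> | lia].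
  split; first by exists H; split=> // /p_le/(leq_trans kp); exists k.
  by apply: ell2_exists; exists H; case: codeH => rkH [_ covH].
(* This gives r/2 - 4 at least [Num.bound eps^-1], and 2^k > k turns it into an error below
   [eps]. *)
exists (Num.bound eps^-1 + 4).*2 => r le_r r_even.
have Er : r = r./2.*2 by rewrite even_halfK.
rewrite Er; apply: le_lt_trans (density_close _) _; first by lia.
rewrite invf_plt ?posrE ?ltr0n ?expn_gt0 //.
apply: lt_le_trans (archi_boundP _) _; first by rewrite invr_ge0 ltW.
rewrite ler_nat; apply: leq_trans _ (ltnW (ltn_expl _ (isT : (1 < 2)%N))).
move: (Num.bound _) le_r => K le_r. lia.
Qed.
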